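(* Let $S$ be a strictly ordered commutative semiring whose order $\le$ is well-founded, and let $T$ be a weighted type graph over $S$. Let $R$ be a set of graph transformation rules partitioned into sets $R^{<}$ and $R^{=}$, such that every rule of $R^{<}$ is decreasing and every rule of $R^{=}$ is non-increasing (with respect to $T$). Then $R$ is terminating if and only if $R^{=}$ is terminating.
   Context: Fix a set $\Lambda$ of edge labels. A graph is $G=\langle V,E,s,t,\ell\rangle$ with finite node set, finite edge set, source/target maps $E\to V$ and labelling $E\to\Lambda$; morphisms preserve source, target and label. A semiring $\langle S,\oplus,\otimes,0,1\rangle$: $\langle S,\oplus,0\rangle$ commutative monoid, $\langle S,\otimes,1\rangle$ monoid, two-sided distributivity, $0$ annihilating; commutative if $\otimes$ is. It is ordered (partial order $\le$) if $x\le y$ implies $x\oplus u\le y\oplus u$, and $x\otimes z\le y\otimes z$, $z\otimes x\le z\otimes y$ for $z\ge0$. It is strongly ordered if additionally $x<y,z<u$ imply $x\oplus z<y\oplus u$, and $z>0,x<y$ imply $x\otimes z<y\otimes z$ and $z\otimes x<z\otimes y$; strictly ordered if in addition $x<y$ implies $x\oplus z<y\oplus z$ for all $z$. Well-founded means there is no infinite strictly decreasing sequence $x_0>x_1>\cdots$. A weighted type graph $T$ over $S$ is a graph with weight function $w_T\colon E_T\to S$ and a flower node $\mathit{fl}_T$ such that for every label $A$ there is a loop $e_A$ on $\mathit{fl}_T$ labelled $A$ with $w_T(e_A)>0$; the flower morphism $\mathit{fl}_G\colon G\to T$ sends all nodes to $\mathit{fl}_T$ and each $A$-labelled edge to $e_A$.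 For $t\colon D\to T$, $w_T(t)=\prod_{e\in E_D}w_T(t(e))$ ($\otimes$-product). For $\phi\colon I\to L$ and $t\colon I\to T$, $w_t(\phi)=\sum_{t_L\colon L\to T,\ t_L\circ\phi=t} w_T(t_L)$ ($\oplus$-sum). A rule $\rho=L\xleftarrow{\phi_L}I\xrightarrow{\phi_R}R$ consists of two graph morphisms with $I$ discrete (no edges); $G\Rightarrow_\rho H$ means there are a match $m\colon L\to G$ (arbitrary morphism), a graph $C$ and morphisms forming two pushout squares $L\leftarrow I\to C$ / $L\to G\leftarrow C$ and $R\leftarrow I\to C$ / $R\to H\leftarrow C$ (double-pushout rewriting). A set of rules $R$ is terminating if there is no infinite sequence $G_0\Rightarrow_{\rho_0}G_1\Rightarrow_{\rho_1}\cdots$ with all $\rho_i\in R$ (starting from any graph). A rule is non-increasing if $w_{t_I}(\phi_L)\ge w_{t_I}(\phi_R)$ for all $t_I\colon I\to T$, and decreasing if it is non-increasing and $w_{\mathit{fl}_I}(\phi_L)>w_{\mathit{fl}_I}(\phi_R)$.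
   Formalization: The formal theorem additionally assumes that every edge weight of T satisfies w_T(e) ≥ 0; without this the claim is false when the order is partial and some weights are incomparable with 0. *)

(* Defs.v *)
(* MathComp, with the classical layer of MathComp-Analysis. *)
From HB Require Import structures.
From mathcomp Require Import all_boot all_order all_algebra.
From mathcomp Require Import boolp.

Set Implicit Arguments.
Unset Strict Implicit.
Unset Printing Implicit Defensive.

Import Order.TTheory GRing.Theory.
Local Open Scope ring_scope.

(* Commutative semirings (0 = 1 allowed) with a partial order on the carrier,
   not required here to be compatible with the operations.  The order is a field
   because Hierarchy-Builder rejects a direct join of the semiring and porder
   structures. *)
Record porderComSemiRing := POrderComSemiRing {
  carrier :> comPzSemiRingType;
  sle : rel carrier;
  sle_refl : reflexive sle;
  sle_anti : antisymmetric sle;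
  sle_trans : transitive sle }.

Definition slt (S : porderComSemiRing) (x y : S) : bool :=
  (x != y) && sle x y.

Notation "x <=s y" := (sle x y) (at level 70, no associativity).
Notation "x <s y" := (slt x y) (at level 70, no associativity).

Section OrderedSemirings.
Variable S : porderComSemiRing.

Definition ordered_semiring : Prop :=
  (forall x y u : S, x <=s y -> x + u <=s y + u) /\
  (forall x y z : S, 0 <=s z -> x <=s y -> x * z <=s y * z /\ z * x <=s z * y).

Definition strongly_ordered_semiring : Prop :=
  [/\ ordered_semiring,
      forall x y z u : S, x <s y -> z <s u -> x + z <s y + u &
      forall x y z : S, 0 <s z -> x <s y -> x * z <s y * z /\ z * x <s z * y].

Definition strictly_ordered_semiring : Prop :=
  strongly_ordered_semiring /\ (forall x y z : S, x <s y -> x + z <s y + z).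

Definition well_founded_order : Prop :=
  ~ exists x : nat -> S, forall i, x i.+1 <s x i.

End OrderedSemirings.

Record graph (Lam : Type) := Graph {
  node : finType;
  edge : finType;
  src : edge -> node;
  tgt : edge -> node;
  lab : edge -> Lam }.

Section Graphs.
Variable Lam : Type.
Implicit Types G H K : graph Lam.

Definition is_morphism G H (fV : node G -> node H) (fE : edge G -> edge H) :
    Prop :=
  forall e, [/\ src (fE e) = fV (src e), tgt (fE e) = fV (tgt e)
              & lab (fE e) = lab e].

(* Morphisms are pairs of finite functions, so that equality of morphisms is
   pointwise and the morphisms between two graphs form a finite type.  The
   classical reflection `[< _ >] avoids assuming decidable equality on Lam. *)
Record ghom G H := Hom {
  hom_val : {ffun node G -> node H} * {ffun edge G -> edge H};
  hom_valP : `[< is_morphism hom_val.1 hom_val.2 >] }.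

HB.instance Definition _ G H := [isSub for @hom_val G H].
HB.instance Definition _ G H := [Finite of ghom G H by <:].

Definition homV G H (f : ghom G H) : node G -> node H := (hom_val f).1.
Definition homE G H (f : ghom G H) : edge G -> edge H := (hom_val f).2.

Lemma homP G H (f : ghom G H) : is_morphism (homV f) (homE f).
Proof. exact/asboolP/(hom_valP f). Qed.

Lemma mk_hom_subproof G H (fV : node G -> node H) (fE : edge G -> edge H) :
  is_morphism fV fE ->
  `[< is_morphism [ffun v => fV v] [ffun e => fE e] >].
Proof. by move=> fP; apply/asboolP => e; rewrite !ffunE; exact: fP. Qed.

Definition mk_hom G H (fV : node G -> node H) (fE : edge G -> edge H)
    (fP : is_morphism fV fE) : ghom G H :=
  @Hom G H ([ffun v => fV v], [ffun e => fE e]) (mk_hom_subproof fP).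

Lemma hom_comp_subproof G H K (g : ghom H K) (f : ghom G H) :
  is_morphism (homV g \o homV f) (homE g \o homE f).
Proof.
move=> e /=; have [<- <- <-] := homP f e.
by have [-> -> ->] := homP g (homE f e).
Qed.

Definition hom_comp G H K (g : ghom H K) (f : ghom G H) : ghom G K :=
  mk_hom (hom_comp_subproof g f).

(* The square with top-left corner A and bottom-right corner D
     A --f--> B --f'--> D    and    A --g--> C --g'--> D
   is a pushout in the category of (finite, labelled) graphs. *)
Definition is_pushout A B C D (f : ghom A B) (g : ghom A C)
    (f' : ghom B D) (g' : ghom C D) : Prop :=
  hom_comp f' f = hom_comp g' g /\
  forall X (h : ghom B X) (k : ghom C X), hom_comp h f = hom_comp k g ->
    exists! u : ghom D X, hom_comp u f' = h /\ hom_comp u g' = k.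

Record rule := Rule {
  lhs : graph Lam;
  itf : graph Lam;
  rhs : graph Lam;
  phiL : ghom itf lhs;
  phiR : ghom itf rhs;
  itf_discrete : edge itf -> False }.

Definition dpo_step (r : rule) G H : Prop :=
  exists (C : graph Lam) (m : ghom (lhs r) G) (c : ghom (itf r) C)
         (g : ghom C G) (n : ghom (rhs r) H) (h : ghom C H),
    is_pushout (phiL r) c m g /\ is_pushout (phiR r) c n h.

Definition terminating (R : rule -> Prop) : Prop :=
  ~ exists (G : nat -> graph Lam) (r : nat -> rule),
      forall i, R (r i) /\ dpo_step (r i) (G i) (G i.+1).

End Graphs.

(* The flower loops e_A are part of the data, because the flower morphisms
   depend on their choice.  Only their weights are constrained here: other
   weights may be negative or incomparable with 0. *)
Record wtype_graph (Lam : Type) (S : porderComSemiRing) := WTypeGraph {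
  tgraph :> graph Lam;
  weight : edge tgraph -> S;
  flower : node tgraph;
  floop : Lam -> edge tgraph;
  floopP : forall A, [/\ src (floop A) = flower, tgt (floop A) = flower
                       & lab (floop A) = A];
  floop_gt0 : forall A, 0 <s weight (floop A) }.

Section Weights.
Variables (Lam : Type) (S : porderComSemiRing) (T : wtype_graph Lam S).

Lemma flower_hom_subproof (G : graph Lam) :
  is_morphism (fun _ : node G => flower T) (fun e : edge G => floop T (lab e)).
Proof. by move=> e; exact: floopP. Qed.

Definition flower_hom (G : graph Lam) : ghom G T :=
  mk_hom (@flower_hom_subproof G).

Definition weight_hom (G : graph Lam) (t : ghom G T) : S :=
  \prod_(e : edge G) weight (homE t e).

Definition weight_along (I L : graph Lam) (phi : ghom I L) (t : ghom I T) : S :=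
  \sum_(tL : ghom L T | hom_comp tL phi == t) weight_hom tL.

Definition nonincreasing_rule (r : rule Lam) : Prop :=
  forall t : ghom (itf r) T, weight_along (phiR r) t <=s weight_along (phiL r) t.

Definition decreasing_rule (r : rule Lam) : Prop :=
  nonincreasing_rule r /\
  weight_along (phiR r) (flower_hom (itf r)) <s
    weight_along (phiL r) (flower_hom (itf r)).

End Weights.

(* Main.v *)
(* Let W(G) be the sum of the weights of all morphisms from G to T.  As the
   interface I of a rule is discrete, in a pushout D of B <- I -> C the edges of
   D are the disjoint union of those of B and C, so W(D) is the sum over
   t : C -> T of w(t) times the weight of I -> B along the restriction of t to I.
   Hence W does not increase along a step of a non-increasing rule, and it
   strictly decreases along a step of a decreasing one because the summand of the
   flower morphism does.  By well-foundedness an infinite derivation uses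
   decreasing rules only finitely often, and a tail of it uses only R^=. *)
Require Import Defs.
From mathcomp Require Import all_boot all_order all_algebra.
From mathcomp Require Import boolp.

Set Implicit Arguments.
Unset Strict Implicit.
Unset Printing Implicit Defensive.

Import GRing.Theory.
Local Open Scope ring_scope.

Section Morphisms.
Variable Lam : Type.
Implicit Types G H K A B C D : graph Lam.

Lemma homV_comp G H K (g : ghom H K) (f : ghom G H) v :
  homV (hom_comp g f) v = homV g (homV f v).
Proof. by rewrite /homV /= ffunE. Qed.

Lemma homE_comp G H K (g : ghom H K) (f : ghom G H) e :
  homE (hom_comp g f) e = homE g (homE f e).
Proof. by rewrite /homE /= ffunE. Qed.

Lemma homV_mk G H fV fE (fP : @is_morphism Lam G H fV fE) v :
  homV (mk_hom fP) v = fV v.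
Proof. by rewrite /homV /= ffunE. Qed.

Lemma homE_mk G H fV fE (fP : @is_morphism Lam G H fV fE) e :
  homE (mk_hom fP) e = fE e.
Proof. by rewrite /homE /= ffunE. Qed.

Lemma hom_ext G H (f g : ghom G H) :
  homV f =1 homV g -> homE f =1 homE g -> f = g.
Proof.
move=> eqV eqE; apply: val_inj => /=.
case: f g eqV eqE => [[fV fE] ?] [[gV gE] ?]; rewrite /homV /homE /= => eqV eqE.
by congr (_, _); apply/ffunP.
Qed.

Lemma hom_compA G H K A (h : ghom K A) (g : ghom H K) (f : ghom G H) :
  hom_comp h (hom_comp g f) = hom_comp (hom_comp h g) f.
Proof.
by apply: hom_ext => x; rewrite ?homV_comp ?homE_comp.
Qed.

Lemma hom_id_subproof G : @is_morphism Lam G G id id.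
Proof. by []. Qed.

Definition hom_id G : ghom G G := mk_hom (@hom_id_subproof G).

Lemma hom_comp1l G H (f : ghom G H) : hom_comp (hom_id H) f = f.
Proof.
by apply: hom_ext => x; rewrite ?homV_comp ?homE_comp ?homV_mk ?homE_mk.
Qed.

Section Pushout.
Variables (A B C D : graph Lam).
Variables (f : ghom A B) (g : ghom A C) (f' : ghom B D) (g' : ghom C D).
Hypothesis A_discrete : edge A -> False.
Hypothesis poD : is_pushout f g f' g'.

(* The nodes of D with the edges of B and C: testing the universal property
   against this graph identifies the edges of D without quotienting nodes. *)
Definition split_graph : graph Lam :=
  @Graph Lam (node D) (edge B + edge C)%type
    (fun e => match e with
              | inl b => homV f' (src b) | inr c => homV g' (src c) end)
    (fun e => match e with
              | inl b => homV f' (tgt b) | inr c => homV g' (tgt c) end)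
    (fun e => match e with inl b => lab b | inr c => lab c end).

Definition merge_edge (e : edge B + edge C) : edge D :=
  match e with inl b => homE f' b | inr c => homE g' c end.

Lemma split_left_subproof :
  @is_morphism Lam B split_graph (homV f') (fun b => inl b).
Proof. by []. Qed.

Lemma split_right_subproof :
  @is_morphism Lam C split_graph (homV g') (fun c => inr c).
Proof. by []. Qed.

Lemma merge_subproof : @is_morphism Lam split_graph D id merge_edge.
Proof. by case=> e; [exact: (homP f' e) | exact: (homP g' e)]. Qed.

(** The inverse is the edge map of the morphism [u] from [D] to [split_graph] that the universal
    property provides. *)
Lemma merge_edge_bij : bijective merge_edge.
Proof.
have [comm univ] := poD.
pose h := mk_hom split_left_subproof; pose k := mk_hom split_right_subproof.
pose v := mk_hom merge_subproof.
(* As [A] has no edges, [h] and [k] need to agree on nodes only, although they send edges into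
   disjoint summands. *)
have hk : hom_comp h f = hom_comp k g.
  apply: hom_ext => [x|e]; last by case: (A_discrete e).
  by rewrite !homV_comp !homV_mk -!homV_comp comm.
have [u [[uf ug] _]] := univ _ _ _ hk.
have vh : hom_comp v h = f'.
  by apply: hom_ext => x; rewrite ?homV_comp ?homE_comp ?homV_mk ?homE_mk.
have vk : hom_comp v k = g'.
  by apply: hom_ext => x; rewrite ?homV_comp ?homE_comp ?homV_mk ?homE_mk.
(* Both [hom_comp v u] and the identity mediate from the cocone [f'], [g'] to itself, so uniqueness
   equates them. *)
have vu : hom_comp v u = hom_id D.
  have [w [_ w_uniq]] := univ D f' g' comm.
  rewrite -(w_uniq (hom_comp v u)); last by rewrite -!hom_compA uf ug.
  by apply: w_uniq; rewrite !hom_comp1l.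
exists (homE u) => [[b|c]|e] /=.
- by rewrite -homE_comp uf homE_mk.
- by rewrite -homE_comp ug homE_mk.
- by have := congr1 (fun w => homE w e) vu; rewrite homE_comp !homE_mk.
Qed.

Lemma weight_hom_pushout (S : porderComSemiRing) (T : wtype_graph Lam S)
    (t : ghom D T) :
  weight_hom t = weight_hom (hom_comp t f') * weight_hom (hom_comp t g').
Proof.
rewrite /weight_hom (reindex merge_edge) /=; last exact/onW_bij/merge_edge_bij.
rewrite big_sumType /=.
by congr (_ * _); apply: eq_bigr => e _; rewrite homE_comp.
Qed.

(** By the universal property, a morphism from [D] to [T] amounts to a pair of morphisms from [B]
    and [C] that agree on [A]. The sum is grouped by the part on [C], then by the part on [B], which
    leaves one morphism per group. *)
Lemma sum_weight_pushout (S : porderComSemiRing) (T : wtype_graph Lam S) :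
  \sum_(t : ghom D T) weight_hom t =
  \sum_(t : ghom C T) weight_hom t * weight_along f (hom_comp t g).
Proof.
have [comm univ] := poD.
rewrite (partition_big (fun t => hom_comp t g') xpredT) //=.
apply: eq_bigr => tC _; rewrite /weight_along mulr_sumr.
rewrite (partition_big (fun t => hom_comp t f')
           (fun tB => hom_comp tB f == hom_comp tC g)) /=; last first.
  by move=> t /eqP <-; rewrite -!hom_compA comm.
apply: eq_bigr => tB /eqP compat.
have [u [[uf ug] u_uniq]] := univ _ _ _ compat.
rewrite (big_pred1 u) => [|t /=].
  by rewrite weight_hom_pushout uf ug mulrC.
apply/andP/eqP => [[/eqP tg /eqP tf]|->]; last by rewrite uf ug.
by apply/esym/u_uniq.
Qed.

End Pushout.
End Morphisms.

Section StrictlyOrdered.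
Variable S : porderComSemiRing.
Hypothesis hS : strictly_ordered_semiring S.

Lemma slt_sle_trans (x y z : S) : x <s y -> y <=s z -> x <s z.
Proof.
case/andP=> xy lexy leyz; apply/andP; split; last exact: sle_trans leyz.
apply: contraNneq xy => xz; apply/eqP/(@sle_anti S).
by rewrite lexy xz.
Qed.

Lemma sle_add (x y z u : S) : x <=s y -> z <=s u -> x + z <=s y + u.
Proof.
have [[[addle _] _ _] _] := hS.
move=> xy zu; apply: (@sle_trans S (y + z)); first exact: addle.
by rewrite ![y + _]addrC; exact: addle.
Qed.

(** Strictness in a single summand is what a strictly ordered semiring adds to a strongly ordered
    one. *)
Lemma slt_sle_add (x y z u : S) : x <s y -> z <=s u -> x + z <s y + u.
Proof.
have [_ addlt] := hS.
move=> xy zu; apply: (@slt_sle_trans _ (y + z)); first exact: addlt.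
by apply: sle_add => //; exact: sle_refl.
Qed.

Lemma sle_sum (I : finType) (P : pred I) (F G : I -> S) :
  (forall i, P i -> F i <=s G i) ->
  \sum_(i | P i) F i <=s \sum_(i | P i) G i.
Proof.
move=> FG; apply: (big_ind2 (fun x y : S => x <=s y)) => //.
  exact: sle_refl.
by move=> *; exact: sle_add.
Qed.

(* The factor may be an empty product, and 0 <= 1 is not available: multiply by
   the factors one at a time. *)
Lemma sle_prod_mul (I : Type) (s : seq I) (F : I -> S) (x y : S) :
  (forall i, 0 <=s F i) -> x <=s y ->
  (\prod_(i <- s) F i) * x <=s (\prod_(i <- s) F i) * y.
Proof.
have [[[_ mulle] _ _] _] := hS.
move=> F0 xy; elim: s => [|i s IHs]; first by rewrite !big_nil !mul1r.
by rewrite !big_cons -!mulrA; have [] := mulle _ _ _ (F0 i) IHs.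
Qed.

Lemma slt_prod_mul (I : Type) (s : seq I) (F : I -> S) (x y : S) :
  (forall i, 0 <s F i) -> x <s y ->
  (\prod_(i <- s) F i) * x <s (\prod_(i <- s) F i) * y.
Proof.
have [[_ _ mullt] _] := hS.
move=> F0 xy; elim: s => [|i s IHs]; first by rewrite !big_nil !mul1r.
by rewrite !big_cons -!mulrA; have [] := mullt _ _ _ (F0 i) IHs.
Qed.

(** If [P] held at arbitrarily late indices, sampling [W] between them would give an infinite strict
    descent. *)
Lemma strict_steps_bounded (W : nat -> S) (P : nat -> Prop) :
  well_founded_order S ->
  (forall i, W i.+1 <=s W i) -> (forall i, P i -> W i.+1 <s W i) ->
  exists n, forall i, (n <= i)%N -> ~ P i.
Proof.
move=> wf noninc dec; apply: contrapT => unbounded; apply: wf.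
have /choice[next nextP] : forall n, exists i, (n <= i)%N /\ P i.
  move=> n; apply: contrapT => none; apply: unbounded; exists n => i ni Pi.
  by apply: none; exists i.
have mono n i : (n <= i)%N -> W i <=s W n.
  move=> /subnKC <-; elim: (i - n)%N => [|k IHk].
    by rewrite addn0; exact: sle_refl.
  by rewrite addnS; exact: sle_trans IHk.
(* The successor moves past the chosen index in [P], so the strict drop there separates consecutive
   terms. *)
exists (fun k => W (iter k (fun n => (next n).+1) 0%N)) => k /=.
set n := iter _ _ _; have [ni Pi] := nextP n.
by apply: slt_sle_trans (mono _ _ ni); exact: dec.
Qed.

Section Steps.
Variables (Lam : Type) (T : wtype_graph Lam S).
Hypothesis weight_ge0 : forall e : edge T, 0 <=s weight e.

Definition graph_weight (G : graph Lam) : S := \sum_(t : ghom G T) weight_hom t.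

(** Both pushouts share the context [C] and the map [c], so the two weights become sums over the
    same morphisms from [C] to [T], compared term by term. *)
Lemma step_nonincreasing r G H :
  nonincreasing_rule T r -> dpo_step r G H ->
  graph_weight H <=s graph_weight G.
Proof.
move=> noninc [C [m [c [g [n [h [poG poH]]]]]]]; have disc := @itf_discrete _ r.
rewrite /graph_weight (sum_weight_pushout disc poG).
rewrite (sum_weight_pushout disc poH).
by apply: sle_sum => t _; apply: sle_prod_mul.
Qed.

Lemma step_decreasing r G H :
  decreasing_rule T r -> dpo_step r G H ->
  graph_weight H <s graph_weight G.
Proof.
move=> [noninc dec] [C [m [c [g [n [h [poG poH]]]]]]].
have disc := @itf_discrete _ r.
rewrite /graph_weight (sum_weight_pushout disc poG).
rewrite (sum_weight_pushout disc poH).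
(* The flower summand is isolated: its restriction along [c] is the flower morphism of the
   interface, where [dec] applies. *)
rewrite (bigD1 (flower_hom T C)) //= [X in _ <s X](bigD1 (flower_hom T C)) //=.
apply: slt_sle_add; last by apply: sle_sum => t _; apply: sle_prod_mul.
have -> : hom_comp (flower_hom T C) c = flower_hom T (itf r).
  apply: hom_ext => [v|e]; last by case: (disc e).
  by rewrite homV_comp !homV_mk.
by apply: slt_prod_mul => // e; rewrite homE_mk; exact: floop_gt0.
Qed.

End Steps.
End StrictlyOrdered.

Theorem theorem1 (Lam : Type) (S : porderComSemiRing)
    (T : wtype_graph Lam S) (R Rlt Req : rule Lam -> Prop)
    (hS : strictly_ordered_semiring S)
    (hwf : well_founded_order S)
    (hT : forall e : edge T, sle 0%R (weight e))
    (hR : forall r, R r <-> Rlt r \/ Req r)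
    (hdisj : forall r, ~ (Rlt r /\ Req r))
    (hlt : forall r, Rlt r -> decreasing_rule T r)
    (heq : forall r, Req r -> nonincreasing_rule T r) :
  terminating R <-> terminating Req.
Proof.
split=> term [G [r run]]; apply: term.
  exists G, r => i; have [ri step] := run i.
  by split=> //; apply/hR; right.
have [|i lti|n tail] := @strict_steps_bounded S
    (fun i => graph_weight T (G i)) (fun i => Rlt (r i)) hwf.
- move=> i; have [/hR ri step] := run i.
  by apply: (step_nonincreasing hS hT _ step); case: ri => [/hlt[]|/heq].
- by have [_ step] := run i; apply: (step_decreasing hS hT (hlt _ lti) step).
(* From index [n] on no rule is in [Rlt], so the shifted run uses [Req] alone. *)
- exists (fun i => G (n + i)%N), (fun i => r (n + i)%N) => i.
  have [/hR ri step] := run (n + i)%N; rewrite addnS; split=> //.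
  by case: ri => // /(tail _ (leq_addr _ _)).
Qed.
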